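(* For any two graphs $G$ and $H$, \[ \mathrm{oh}(G\circ H)\geq \mathrm{oh}(G\boxtimes H)\geq \begin{cases}\Delta(G)+1, & \text{if } \Delta(G)=\Delta(H),\\ \min\{\Delta(G),\Delta(H)\}+2, & \text{otherwise,}\end{cases} \] where $G\circ H$ denotes the lexicographic product and $G\boxtimes H$ the strong product.
   Context: All graphs are finite, simple and loopless; $\Delta(G)$ is the maximum degree. $\mathrm{oh}(G)$ (Odd Hadwiger number) is the largest integer $m$ for which there exist $m$ pairwise vertex-disjoint trees $Z_1,\dots,Z_m$ in $G$ and a 2-colouring $c$ of $V(Z_1)\cup\dots\cup V(Z_m)$ that is proper on each $Z_k$, such that for every $k\neq k'$ there is an edge $xy\in E(G)$ with $x\in V(Z_k)$, $y\in V(Z_{k'})$, $c(x)=c(y)$. Both products have vertex set $V(G)\times V(H)$. Lexicographic product: $(v_1,u_1)\sim(v_2,u_2)$ iff $v_1v_2\in E(G)$, or ($v_1=v_2$ and $u_1u_2\in E(H)$). Strong product: $(v_1,u_1)\sim(v_2,u_2)$ iff ($v_1=v_2$ and $u_1u_2\in E(H)$), or ($u_1=u_2$ and $v_1v_2\in E(G)$), or ($v_1v_2\in E(G)$ and $u_1u_2\in E(H)$). *)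

(* Defs.v *)
From mathcomp Require Import all_boot.
From mathcomp Require Import boolp.

Set Implicit Arguments.
Unset Strict Implicit.
Unset Printing Implicit Defensive.

Record graph := Graph {
  vertex :> finType;
  adj : rel vertex;
  adj_sym : symmetric adj;
  adj_irrefl : irreflexive adj }.

Definition degree (G : graph) (x : G) : nat := #|[set y : G | adj x y]|.

(* For the graph without vertices this is 0. *)
Definition max_degree (G : graph) : nat := \max_(x : G) degree x.

(* Subgraphs are not required to be induced. *)
Record subgraph (G : graph) := Subgraph {
  sub_verts : {set G};
  sub_adj : rel G;
  sub_adj_sym : symmetric sub_adj;
  sub_adjP : forall x y, sub_adj x y ->
    [/\ x \in sub_verts, y \in sub_verts & adj x y] }.

(* A [ucycle] of size at least 3 is a cycle in the graph-theoretic sense;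
   a [ucycle] of size 2 only runs back and forth along one edge. *)
Definition is_tree (G : graph) (Z : subgraph G) : Prop :=
  [/\ sub_verts Z != set0,
      {in sub_verts Z &, forall x y, connect (sub_adj Z) x y}
    & forall p : seq G, ucycle (sub_adj Z) p -> size p < 3].

(* The colouring [c] is total on [G]; only its values on the vertices of the
   trees are constrained. *)
Definition odd_clique_minor (G : graph) (m : nat) : Prop :=
  exists (Z : 'I_m -> subgraph G) (c : G -> bool),
    [/\ forall k, is_tree (Z k),
        forall k k', k != k' -> [disjoint sub_verts (Z k) & sub_verts (Z k')],
        forall k x y, sub_adj (Z k) x y -> c x != c y
      & forall k k', k != k' ->
          exists x y, [/\ x \in sub_verts (Z k), y \in sub_verts (Z k'),
                          adj x y & c x = c y]].

(* The bound on [m] loses nothing, since [m] disjoint trees occupy at least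
   [m] vertices: see [oh_witness] and [oh_max]. *)
Definition oh (G : graph) : nat :=
  \max_(m < #|G|.+1 | `[< odd_clique_minor G m >]) m.

Lemma odd_clique_minor_le (G : graph) m : odd_clique_minor G m -> m <= #|G|.
Proof.
move=> [Z [c [treeZ disjZ _ _]]].
have ex k : exists x, x \in sub_verts (Z k).
  by have [/set0Pn] := treeZ k.
pose f k := xchoose (ex k).
have fP k : f k \in sub_verts (Z k) by apply: xchooseP.
have inj_f : injective f.
  move=> k k' eq_f; apply/eqP; apply/negPn/negP => /disjZ /disjointFr dis.
  by have := dis _ (fP k); rewrite eq_f fP.
by rewrite -[m]card_ord; apply: leq_card inj_f.
Qed.

Lemma oh_max (G : graph) m : odd_clique_minor G m -> m <= oh G.
Proof.
move=> Gm; have le_m := odd_clique_minor_le Gm.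
rewrite /oh -[m]/(nat_of_ord (Ordinal (le_m : m < #|G|.+1))).
by apply: leq_bigmax_cond; apply/asboolP.
Qed.

Lemma oh_witness (G : graph) : odd_clique_minor G (oh G).
Proof.
rewrite /oh; elim/big_ind: _ => [|m n Gm Gn|i /asboolP //].
  have Z0 : 'I_0 -> subgraph G by case.
  by exists Z0, xpredT; split; case.
by rewrite /maxn; case: ifP.
Qed.

Section Products.
Variables G H : graph.

Definition lex_adj : rel (G * H) := fun p q =>
  adj p.1 q.1 || (p.1 == q.1) && adj p.2 q.2.

Lemma lex_adj_sym : symmetric lex_adj.
Proof.
by move=> p q; rewrite /lex_adj [adj q.1 _]adj_sym [adj q.2 _]adj_sym eq_sym.
Qed.

Lemma lex_adj_irrefl : irreflexive lex_adj.
Proof. by move=> p; rewrite /lex_adj !adj_irrefl andbF. Qed.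

Definition lex_product : graph := Graph lex_adj_sym lex_adj_irrefl.

Definition strong_adj : rel (G * H) := fun p q =>
  [|| (p.1 == q.1) && adj p.2 q.2,
      (p.2 == q.2) && adj p.1 q.1
    | adj p.1 q.1 && adj p.2 q.2].

Lemma strong_adj_sym : symmetric strong_adj.
Proof.
move=> p q; rewrite /strong_adj [adj q.1 _]adj_sym [adj q.2 _]adj_sym.
by rewrite [q.1 == _]eq_sym [q.2 == _]eq_sym.
Qed.

Lemma strong_adj_irrefl : irreflexive strong_adj.
Proof. by move=> p; rewrite /strong_adj !adj_irrefl !andbF. Qed.

Definition strong_product : graph := Graph strong_adj_sym strong_adj_irrefl.

End Products.

(* Main.v *)
(** For a star with centre [x] and leaves [a_0, a_1, ...] in [G] and one with
    centre [y] and leaves [b_0, b_1, ...] in [H], every [(a_i, y)] is adjacent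
    to every [(x, b_j)] in the strong product.  The paths
    [(a_i, y) - (a_i, b_i) - (x, b_i)] are disjoint, and if all vertices with a
    coordinate [x] or [y] get one colour and the [(a_i, b_i)] the other, the
    colouring is proper on these paths and any two are joined by a monochromatic
    edge.  The universal vertex [(x, y)] is one more tree, and if there is one
    more [b] than [a]'s, say [b_d], then [(x, b_d)] is yet another. *)
Require Import Defs.
From mathcomp Require Import all_boot.

Set Implicit Arguments.
Unset Strict Implicit.
Unset Printing Implicit Defensive.

Section Transport.
Variables (G H : graph) (f : G -> H) (g : H -> G).
Hypotheses (fK : cancel f g) (gK : cancel g f).
Hypothesis adj_f : forall x y, adj x y -> adj (f x) (f y).

(** Pulling back along [g] gives the image of [Z] under [f], as the two maps are mutually
    inverse. *)
Definition transport_adj (Z : subgraph G) : rel H := relpre g (sub_adj Z).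

Lemma transport_adj_sym Z : symmetric (transport_adj Z).
Proof. by move=> p q; rewrite /transport_adj /= sub_adj_sym. Qed.

Lemma transport_adjP Z p q : transport_adj Z p q ->
  [/\ p \in g @^-1: sub_verts Z, q \in g @^-1: sub_verts Z & adj p q].
Proof.
by move=> /sub_adjP[Zp Zq /adj_f]; rewrite !inE !gK.
Qed.

Definition transport Z := Subgraph (@transport_adj_sym Z) (@transport_adjP Z).

Lemma transport_tree Z : is_tree Z -> is_tree (transport Z).
Proof.
move=> [/set0Pn[x Zx] conZ acyclicZ]; split=> /=.
- by apply/set0Pn; exists (f x); rewrite inE fK.
- move=> p q; rewrite !inE => Zp Zq.
  have /connectP[s e_s last_s] := conZ _ _ Zp Zq.
  apply/connectP; exists (map f s).
    by rewrite -path_map -map_comp (eq_map fK) map_id.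
  by rewrite -[p]gK last_map -last_s gK.
- move=> s /andP[cyc_s uniq_s]; rewrite -(size_map g); apply: acyclicZ.
  rewrite /ucycle map_inj_uniq ?uniq_s ?andbT; last exact: can_inj gK.
  by case: s cyc_s {uniq_s} => //= z s; rewrite -map_rcons path_map.
Qed.

(** A bijection that maps edges to edges carries along the trees, the colouring and the
    monochromatic edges. This serves both to pass from the strong to the lexicographic product and
    to exchange the two factors. *)
Lemma odd_clique_minor_transport m : odd_clique_minor G m -> odd_clique_minor H m.
Proof.
move=> [Z [c [treeZ disjZ colZ edgeZ]]].
exists (transport \o Z), (c \o g); split=> /=.
- by move=> k; apply: transport_tree.
- move=> k k' /disjZ; rewrite -!setI_eq0 -preimsetI => /eqP->.
  by rewrite preimset0.
- by move=> k p q /colZ.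
- move=> k k' /edgeZ[p [q [Zp Zq pq cpq]]].
  by exists (f p), (f q); split; rewrite ?inE ?fK //; apply: adj_f.
Qed.

Lemma oh_transport : oh G <= oh H.
Proof. exact/oh_max/odd_clique_minor_transport/oh_witness. Qed.

End Transport.

Section Star.
Variables (G : graph) (v : G) (L : {set G}).
Hypothesis adj_vL : {in L, forall x, adj v x}.

(** The leaf set [L] may be empty, so single vertices are stars, as are paths on three vertices,
    centred at their midpoints. *)
Definition star_adj : rel G := fun x y =>
  (x == v) && (y \in L) || (y == v) && (x \in L).

Lemma star_adj_sym : symmetric star_adj.
Proof. by move=> x y; rewrite /star_adj orbC. Qed.

Lemma star_adjP x y : star_adj x y -> [/\ x \in v |: L, y \in v |: L & adj x y].
Proof.
case/orP=> /andP[/eqP-> Lz]; rewrite !inE eqxx Lz ?orbT; split=> //.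
  exact: adj_vL.
by rewrite adj_sym adj_vL.
Qed.

Definition star := Subgraph star_adj_sym star_adjP.

Lemma star_tree : is_tree star.
Proof.
split=> /=.
- by apply/set0Pn; exists v; rewrite setU11.
- have conv x : x \in v |: L -> connect star_adj v x.
    case/setU1P=> [->//|Lx]; apply: connect1.
    by rewrite /star_adj eqxx Lx.
  move=> x y /conv vx /conv; apply: connect_trans.
  by rewrite (sym_connect_sym star_adj_sym).
- have at_v x y : star_adj x y -> (x == v) || (y == v).
    by case/orP=> /andP[-> _]; rewrite ?orbT.
  case=> [|x0 [|x1 [|x2 s]]] // /andP[/= /and3P[/at_v e01 /at_v e12 es]].
  case/and4P; rewrite !inE !negb_or => /and3P[n01 n02 n0s] /andP[n12 n1s] n2s _.
  (* Both of the first two edges contain [v], and [x0] differs from [x2], so [v] is their common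
     vertex [x1]. The next edge, whether it returns to [x0] or goes on to [x3], then misses [v]. *)
  have x1v : x1 = v.
    case/orP: e01 => /eqP // e0; case/orP: e12 => /eqP // e.
    by rewrite e0 e eqxx in n02.
  case: s es n1s n0s {n2s} => [|x3 s] /= /andP[/at_v e23 _];
    rewrite ?inE ?negb_or -?x1v in e23 * => n1s n0s.
    by rewrite (negPf n01) orbF eq_sym (negPf n12) in e23.
  case/andP: n1s => n13 _.
  by rewrite eq_sym (negPf n12) eq_sym (negPf n13) in e23.
Qed.

End Star.

(** Disjointness comes from [r], which reads off each vertex of a star the index of that star. *)
Lemma odd_clique_minor_stars (G : graph) m (v : 'I_m -> G) (L : 'I_m -> {set G})
    (r : G -> nat) (c : G -> bool) :
    (forall k, {in L k, forall x, adj (v k) x}) ->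
    (forall k, {in v k |: L k, forall x, r x = k}) ->
    (forall k, {in L k, forall x, c (v k) != c x}) ->
    (forall k k' : 'I_m, k < k' -> exists x y,
       [/\ x \in v k |: L k, y \in v k' |: L k', adj x y & c x = c y]) ->
  odd_clique_minor G m.
Proof.
move=> adjL rP cP edge; exists (fun k => star (adjL k)), c; split=> /=.
- by move=> k; apply: star_tree.
- move=> k k' neq; rewrite -setI_eq0; apply/eqP/setP=> x; rewrite in_setI in_set0.
  apply/negP=> /andP[/rP rk /rP rk']; case/eqP: neq.
  by apply: val_inj; rewrite /= -rk rk'.
- by move=> k x y /orP[]/andP[/eqP-> /cP //]; rewrite eq_sym.
- move=> k k'; rewrite -val_eqE neq_ltn /= => /orP[/edge//|/edge[x [y [? ? ? ?]]]].
  by exists y, x; split; rewrite // adj_sym.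
Qed.

Lemma strong_product_stars (G H : graph) (x : G) (y : H) (s : seq G) (t : seq H) :
    uniq s -> uniq t ->
    {in s, forall z, adj x z} -> {in t, forall z, adj y z} ->
    size s <= size t <= (size s).+1 ->
  odd_clique_minor (strong_product G H) (size t).+1.
Proof.
move=> uniq_s uniq_t xs yt /andP[le_st le_ts].
have adj_neq (K : graph) (z z' : K) : adj z z' -> (z' == z) = false.
  by move=> zz'; apply/eqP=> e; rewrite e adj_irrefl in zz'.
(* The default values make the tree of index [size t] the vertex [(x, y)] and,
   when [size t = (size s).+1], the one of index [size s] a vertex [(x, b)]. *)
pose a k := nth x s k; pose b k := nth y t k.
have aP k : k < size s -> adj x (a k) by move=> lt_k; apply/xs/mem_nth.
have bP k : k < size t -> adj y (b k) by move=> lt_k; apply/yt/mem_nth.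
have b0 k : k < (size t).+1 -> (b k == y) = (k == size t).
  rewrite ltnS leq_eqVlt => /orP[/eqP->|lt_k]; first by rewrite /b nth_default ?eqxx.
  by rewrite (adj_neq _ _ _ (bP _ lt_k)) ltn_eqF.
pose L k : {set strong_product G H} :=
  if k < size s then [set (a k, y); (x, b k)] else set0.
(* In the tree of index [k], a second coordinate other than [y] is [b k]; when it is [y], the vertex
   is [(x, y)] or [(a k, y)]. *)
pose r (p : G * H) :=
  if p.2 != y then index p.2 t else if p.1 == x then size t else index p.1 s.
pose c (p : G * H) := (p.1 == x) || (p.2 == y).
have LP k p : p \in L k -> k < size s /\ (p = (a k, y) \/ p = (x, b k)).
  by rewrite /L; case: ifP => [lt_k /set2P //|]; rewrite inE.
apply: (@odd_clique_minor_stars (strong_product G H) _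
          (fun k => (a k, b k)) (fun k => L k) r c).
- move=> k p /LP[lt_k]; have lt_kt := leq_trans lt_k le_st.
  case=> ->; rewrite /= /strong_adj /= !eqxx.
    by rewrite adj_sym bP.
  by rewrite [adj (a k) x]adj_sym aP ?orbT.
- move=> k p; have rb z : k < size t \/ z == x -> r (z, b k) = k.
    rewrite /r /= b0 //; case: (eqVneq (k : nat) (size t)) => /= [->|neq _].
      by rewrite ltnn => -[//|->].
    by rewrite index_uniq // ltn_neqAle neq -ltnS ltn_ord.
  case/setU1P=> [->|/LP[lt_k]].
    have [lt_k|ge_k] := ltnP k (size s).
      by apply: rb; left; apply: leq_trans le_st.
    by apply: rb; right; rewrite /a nth_default.
  case=> ->; last by apply: rb; right.
  by rewrite /r /= eqxx /= (adj_neq _ _ _ (aP _ lt_k)) index_uniq.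
- move=> k p /LP[lt_k]; have lt_kt := leq_trans lt_k le_st.
  rewrite {1}/c /= (adj_neq _ _ _ (aP _ lt_k)) (adj_neq _ _ _ (bP _ lt_kt)).
  by case=> ->; rewrite /c /= eqxx ?orbT.
- move=> k k' lt_kk'.
  (* Every tree contains [(x, b j)]: as a leaf of a path, or as the centre of a single-vertex tree,
     where [a j] defaults to [x]. *)
  have xbP (j : 'I_(size t).+1) : (x, b j) \in (a j, b j) |: L j.
    rewrite /L; case: ltnP => [_|ge_j]; first by rewrite !inE eqxx !orbT.
    by rewrite /a nth_default // setU11.
  have [lt_k|ge_k] := ltnP k (size s).
    exists (a k, y), (x, b k'); split=> //; last by rewrite /c /= !eqxx orbT.
      by rewrite /L lt_k !inE eqxx orbT.
    rewrite /= /strong_adj /= [adj (a k) x]adj_sym aP //= andbT.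
    rewrite [y == _]eq_sym b0 //; have [|neq] := eqVneq (k' : nat) (size t); first by rewrite orbT.
    by rewrite bP ?orbT // ltn_neqAle neq -ltnS ltn_ord.
  (* Neither tree is a path now, and the bounds on the sizes leave only [k = size s] and
     [k' = size t = k + 1]: the extra vertex [(x, b k)] and the universal vertex [(x, y)]. *)
  have lt_k't : k' <= size t by rewrite -ltnS.
  have k't : k' = size t :> nat.
    apply/eqP; rewrite eqn_leq lt_k't (leq_trans le_ts) //.
    exact: leq_ltn_trans lt_kk'.
  exists (x, b k), (x, b k'); split=> //; last by rewrite /c /= !eqxx.
  have -> : b k' = y by rewrite /b k't nth_default.
  by rewrite /= /strong_adj /= eqxx adj_sym bP //; apply: leq_trans lt_k't.
Qed.

Lemma max_degree_witness (G : graph) : 0 < #|G| ->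
  exists (x : G) (s : seq G),
    [/\ uniq s, {in s, forall z, adj x z} & size s = max_degree G].
Proof.
move=> /(eq_bigmax (@degree G))[x degx].
exists x, (enum [set z : G | adj x z]); split; first exact: enum_uniq.
  by move=> z; rewrite mem_enum inE.
by rewrite -cardE /max_degree degx.
Qed.

Lemma oh_strong_productC (G H : graph) :
  oh (strong_product G H) <= oh (strong_product H G).
Proof.
pose swap (A B : Type) (p : A * B) := (p.2, p.1).
apply: (@oh_transport (strong_product G H) (strong_product H G)
          (@swap G H) (@swap H G)); [by case | by case |].
by move=> p q; rewrite /= /strong_adj /= => /or3P[] /andP[-> ->]; rewrite ?orbT.
Qed.

Lemma oh_strong_product_lt (G H : graph) : 0 < #|G| -> 0 < #|H| ->
  max_degree G < max_degree H -> (max_degree G).+2 <= oh (strong_product G H).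
Proof.
move=> /max_degree_witness[x [s [uniq_s xs <-]]].
move=> /max_degree_witness[y [t [uniq_t yt <-]]] lt_st.
(* Only [(size s).+1] neighbours of [y] are kept, one more than [x] has; with the universal vertex
   this makes [(size s).+2] trees. *)
rewrite -(size_takel lt_st); apply/oh_max/(strong_product_stars (y := y) uniq_s _ xs).
- exact: take_uniq.
- by move=> z /mem_take; apply: yt.
- by rewrite size_takel // leqnSn leqnn.
Qed.

Theorem theorem4 (G H : graph) :
  oh (strong_product G H) <= oh (lex_product G H) /\
  (0 < #|G| -> 0 < #|H| ->
   (if max_degree G == max_degree H then (max_degree G).+1
    else (minn (max_degree G) (max_degree H)).+2)
   <= oh (strong_product G H)).
Proof.
split.
  apply: (@oh_transport (strong_product G H) (lex_product G H) id id) => // p q.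
  rewrite /= /strong_adj /lex_adj.
  by case/or3P=> /andP[e1 e2]; rewrite ?e1 ?e2 ?orbT.
move=> G0 H0; case: (ltngtP (max_degree G)) => [lt_GH|lt_HG|eq_GH].
- exact: oh_strong_product_lt.
- apply: leq_trans (oh_strong_productC _ _).
  exact: oh_strong_product_lt.
- have [x [s [uniq_s xs size_s]]] := max_degree_witness G0.
  have [y [t [uniq_t yt size_t]]] := max_degree_witness H0.
  rewrite eq_GH -size_t; apply/oh_max/(strong_product_stars uniq_s uniq_t xs yt).
  by rewrite size_s size_t eq_GH leqnn leqnSn.
Qed.
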